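(* Let $X$ be a real normed space and $Y$ a real Banach space. Let $\psi:X\times X\to[0,\infty)$ be a function such that $$\sum_{i=0}^{\infty}16^i\psi(0,2^{-i-1}x)<\infty\quad\text{and}\quad\lim_{n\to\infty}16^n\psi(2^{-n}x,2^{-n}y)=0$$ for all $x,y\in X$. Suppose that a function $f:X\to Y$ satisfies the inequality $$\|D_f(x,y)\|\leq\psi(x,y)$$ for all $x,y\in X$, and $f(0)=0$. Then there exist a unique quartic function $Q:X\to Y$ and a unique additive function $A:X\to Y$ such that both $g=Q$ and $g=A$ satisfy $$g(2x+y)+g(2x-y)=4\bigl(g(x+y)+g(x-y)\bigr)-\frac{3}{7}\bigl(g(2y)-2g(y)\bigr)+2g(2x)-8g(x)$$ for all $x,y\in X$, and $$\|f(x)-Q(x)-A(x)\|\leq\sum_{i=0}^{\infty}\left(\frac{16^i}{3}+2^i\right)\left(\frac{\psi(0,2^{-i-1}x)+\psi(0,-2^{-i-1}x)}{2}\right)$$ for all $x\in X$.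
   Context: For a function $f:X\to Y$, define $D_f:X\times X\to Y$ by $$D_f(x,y)=7[f(2x+y)+f(2x-y)]-28[f(x+y)+f(x-y)]+3[f(2y)-2f(y)]-14[f(2x)-4f(x)].$$ A function $Q:X\to Y$ is called quartic if $Q(2x+y)+Q(2x-y)=4(Q(x+y)+Q(x-y))+24Q(x)-6Q(y)$ for all $x,y\in X$. A function $A:X\to Y$ is additive if $A(x+y)=A(x)+A(y)$ for all $x,y\in X$. *)

(* Defs.v *)
From HB Require Import structures.
From mathcomp Require Import all_boot all_order all_algebra.
From mathcomp Require Import all_classical all_reals all_analysis.
Set Implicit Arguments.
Unset Strict Implicit.
Unset Printing Implicit Defensive.
Import Order.TTheory GRing.Theory Num.Theory.
Import numFieldNormedType.Exports.
Local Open Scope classical_set_scope.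
Local Open Scope ring_scope.

Definition D_ (R : realType) (X Y : lmodType R) (f : X -> Y) (x y : X) : Y :=
  7 *: (f (2 *: x + y) + f (2 *: x - y)) - 28 *: (f (x + y) + f (x - y))
  + 3 *: (f (2 *: y) - 2 *: f y) - 14 *: (f (2 *: x) - 4 *: f x).

Definition quartic (R : realType) (X Y : lmodType R) (Q : X -> Y) : Prop :=
  forall x y : X,
    Q (2 *: x + y) + Q (2 *: x - y)
    = 4 *: (Q (x + y) + Q (x - y)) + 24 *: Q x - 6 *: Q y.

Definition additive_function (R : realType) (X Y : lmodType R) (A : X -> Y) :
    Prop :=
  forall x y : X, A (x + y) = A x + A y.

Definition mixed_equation (R : realType) (X Y : lmodType R) (g : X -> Y) :
    Prop :=
  forall x y : X,
    g (2 *: x + y) + g (2 *: x - y)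
    = 4 *: (g (x + y) + g (x - y)) - (3 / 7) *: (g (2 *: y) - 2 *: g y)
      + 2 *: g (2 *: x) - 8 *: g x.

(* Main.v *)
(* The even part h = f_e and the odd part h = f_o of f still almost satisfy
   D_h = 0, with control function the symmetrization of psi.  At x = 0 this says
   that |3 (h (2y) - c h y)| is at most the symmetrization of psi 0 y, where
   c = 16 for the even part and c = 2 for the odd one.  Hence c^n h (2^-n x) is
   a Cauchy sequence; its limits Q (even) and A (odd) satisfy D_Q = D_A = 0.
   Substituting Q (2x) = 16 Q x gives the quartic equation; substituting
   A (2x) = 2 A x leaves
     A (2x + y) + A (2x - y) = 4 (A (x + y) + A (x - y)) - 4 A x,
   eight instances of which combine linearly to Jensen's equation.
   For uniqueness, the even and odd parts of the difference of two
   approximations scale by 16 and 2 under doubling, whereas c^n times the error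
   bound at 2^-n x is dominated by the tail of a convergent series. *)
Require Import Defs.
From HB Require Import structures.
From mathcomp Require Import all_boot all_order all_algebra.
From mathcomp Require Import all_classical all_reals all_analysis.
From mathcomp Require Import ring lra.
Set Implicit Arguments.
Unset Strict Implicit.
Unset Printing Implicit Defensive.
Import Order.TTheory GRing.Theory Num.Theory.
Import numFieldNormedType.Exports.
Local Open Scope classical_set_scope.
Local Open Scope ring_scope.

(** * Linear identities in modules, decided by reflection *)

Inductive lin_expr (R : Type) :=
  | LVar of nat
  | LZero
  | LAdd of lin_expr R & lin_expr R
  | LOpp of lin_expr R
  | LScale of R & lin_expr R.

Fixpoint lin_eval (R : pzRingType) (V : lmodType R) (env : seq V)
    (t : lin_expr R) : V :=
  match t with
  | LVar i => nth 0 env i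
  | LZero => 0
  | LAdd a b => lin_eval env a + lin_eval env b
  | LOpp a => - lin_eval env a
  | LScale c a => c *: lin_eval env a
  end.

Fixpoint lin_coef (R : pzRingType) (t : lin_expr R) (j : nat) : R :=
  match t with
  | LVar i => if Nat.eqb i j then 1 else 0
  | LZero => 0
  | LAdd a b => lin_coef a j + lin_coef b j
  | LOpp a => - lin_coef a j
  | LScale c a => c * lin_coef a j
  end.

(** Recursion on a concrete [n] lets [cbv] unfold this into a finite conjunction of scalar
    identities, ready for [lra] or [ring]. *)
Fixpoint lin_coef_eq (R : pzRingType) (n : nat) (s t : lin_expr R) : Prop :=
  if n is m.+1 then lin_coef s m = lin_coef t m /\ lin_coef_eq m s t else True.

Lemma lin_eval_coef (R : pzRingType) (V : lmodType R) (env : seq V)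
    (t : lin_expr R) :
  lin_eval env t = \sum_(j < size env) lin_coef t j *: env`_j.
Proof.
elim: t => [i||a IHa b IHb|a IHa|c a IHa] /=.
- have nE k : Nat.eqb i k = (i == k) by apply/PeanoNat.Nat.eqb_spec/eqP.
  case: (ltnP i (size env)) => [lti|gei].
    rewrite (bigD1 (Ordinal lti)) //= nE eqxx scale1r big1 ?addr0 // => k ki.
    by rewrite nE ifN ?scale0r // eq_sym.
  rewrite nth_default // big1 // => k _.
  by rewrite nE ifN ?scale0r // gtn_eqF // (leq_trans (ltn_ord k)).
- by rewrite big1 // => k _; rewrite scale0r.
- by rewrite IHa IHb -big_split; apply: eq_bigr => k _; rewrite scalerDl.
- by rewrite IHa -sumrN; apply: eq_bigr => k _; rewrite scaleNr.
- by rewrite IHa scaler_sumr; apply: eq_bigr => k _; rewrite scalerA.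
Qed.

Lemma lin_eval_eq (R : pzRingType) (V : lmodType R) (env : seq V)
    (s t : lin_expr R) :
  lin_coef_eq (size env) s t -> lin_eval env s = lin_eval env t.
Proof.
move=> st; rewrite !lin_eval_coef; apply: eq_bigr => -[j +] _ /=.
elim: (size env) st => //= n IHn [stn stlt]; rewrite ltnS leq_eqVlt.
by case/predU1P => [-> | /(IHn stlt)//]; rewrite stn.
Qed.

(* Atoms are compared up to conversion, because equal subterms may carry
   different paths in the algebraic hierarchy. *)
Ltac lin_index x env :=
  match env with
  | ?y :: _ =>
      let _ := match constr:(Set) with _ => unify x y end in constr:(0%N)
  | _ :: ?e => let i := lin_index x e in constr:(i.+1)
  end.

Ltac lin_insert x env :=
  match constr:(Set) with
  | _ => let _ := lin_index x env in env
  | _ => constr:(x :: env)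
  end.

Ltac lin_atoms t env :=
  lazymatch t with
  | @GRing.add _ ?a ?b => let e := lin_atoms a env in lin_atoms b e
  | @GRing.opp _ ?a => lin_atoms a env
  | @GRing.scale _ _ _ ?a => lin_atoms a env
  | @GRing.zero _ => env
  | _ => lin_insert t env
  end.

Ltac lin_reify R t env :=
  lazymatch t with
  | @GRing.add _ ?a ?b =>
      let a' := lin_reify R a env in
      let b' := lin_reify R b env in constr:(@LAdd R a' b')
  | @GRing.opp _ ?a => let a' := lin_reify R a env in constr:(@LOpp R a')
  | @GRing.scale _ _ ?c ?a =>
      let a' := lin_reify R a env in constr:(@LScale R c a')
  | @GRing.zero _ => constr:(@LZero R)
  | _ => let i := lin_index t env in constr:(@LVar R i)
  end.

Ltac lin_comb R :=
  lazymatch goal with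
  | |- @eq ?T ?a ?b =>
      let e := lin_atoms a (@nil T) in
      let env := lin_atoms b e in
      let a' := lin_reify R a env in
      let b' := lin_reify R b env in
      refine (@lin_eval_eq R _ env a' b' _);
      cbv [lin_coef_eq lin_coef Nat.eqb size];
      repeat split; first [lra | ring]
  end.

Lemma eq_addZ (R : pzRingType) (V : lmodType R) (c : R) (u v u' v' : V) :
  u = v -> u' = v' -> u + c *: u' = v + c *: v'.
Proof. by move=> -> ->. Qed.

(** Derives a vector equation from a known one once the multiplier [c] is named: the second premise
    is a formal identity that [lin_comb] checks. *)
Lemma eq_lin_comb (R : pzRingType) (V : lmodType R) (c : R) (u v u' v' : V) :
  u' = v' -> u - v = c *: (u' - v') -> u = v.
Proof. by move=> ->; rewrite subrr scaler0 => /subr0_eq. Qed.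

(** * Sequences with summable steps in a Banach space *)

Lemma cvg_summable_steps (R : realType) (Y : completeNormedModType R)
    (s : nat -> Y) (a : nat -> R) :
  (forall n, `|s n.+1 - s n| <= a n) ->
  (\sum_(0 <= i <oo) (a i)%:E < +oo)%E ->
  cvgn s /\ (`|s 0 - limn s|%:E <= \sum_(0 <= i <oo) (a i)%:E)%E.
Proof.
move=> sa afin.
have a0 n : 0 <= a n by rewrite (le_trans _ (sa n)).
have aE0 n : (0 <= (a n)%:E)%E by rewrite lee_fin.
have S0 : (0 <= \sum_(0 <= i <oo) (a i)%:E)%E by apply: nneseries_ge0.
have SE : (\sum_(0 <= i <oo) (a i)%:E)%E \is a fin_num by rewrite ge0_fin_numE.
rewrite -(fineK SE) lee_fin; set M := fine _.
have aM n : \sum_(0 <= i < n) a i <= M.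
  rewrite -lee_fin (fineK SE) -sumEFin.
  exact: (nneseries_lim_ge (P := xpredT)).
have scvg : cvgn s.
  (* The series of increments converges absolutely, hence converges by completeness of [Y]; its
     partial sums are [s n - s 0]. *)
  have : cvgn [normed series (telescope s)].
    apply: nondecreasing_is_cvgn.
      by apply: nondecreasing_series => n _ _; exact: normr_ge0.
    exists M => _ [n _ <-]; apply: le_trans (aM n).
    by rewrite /normed_series_of; apply: ler_sum => i _; exact: sa.
  move=> /normed_cvg; rewrite telescopeK => /cvg_ex[l sl].
  apply/cvg_ex; exists (l + s 0).
  have {1}-> : s = (fun n => s n - s 0) + cst (s 0).
    by apply/funext => n /=; rewrite subrK.
  exact: cvgD sl (cvg_cst (s 0)).
split=> //.
have slim : `|s 0 - s n| @[n --> \oo] --> `|s 0 - limn s|.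
  by apply: cvg_norm; apply: cvgB => //; exact: cvg_cst.
apply: (cvgr_to_le slim); apply: nearW => n; apply: le_trans (aM n).
rewrite distrC -telescope_sumr //; apply: le_trans (ler_norm_sum _ _ _) _.
by apply: ler_sum.
Qed.

(** * Behaviour of [D_] under rescaling and parity *)

Lemma D_scale (R : realType) (X Y : lmodType R) (c q : R) (f : X -> Y) x y :
  D_ (fun z => c *: f (q *: z)) x y = c *: D_ f (q *: x) (q *: y).
Proof.
rewrite /D_.
have -> : q *: (2 *: x + y) = 2 *: (q *: x) + q *: y by lin_comb R.
have -> : q *: (2 *: x - y) = 2 *: (q *: x) - q *: y by lin_comb R.
have -> : q *: (x + y) = q *: x + q *: y by lin_comb R.
have -> : q *: (x - y) = q *: x - q *: y by lin_comb R.
have -> : q *: (2 *: x) = 2 *: (q *: x) by lin_comb R.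
have -> : q *: (2 *: y) = 2 *: (q *: y) by lin_comb R.
lin_comb R.
Qed.

(* The even part of f for e = 1, its odd part for e = -1. *)
Definition parity_part (R : realType) (X Y : lmodType R) (e : R) (f : X -> Y)
  (x : X) : Y := 2^-1 *: (f x + e *: f (- x)).

Lemma D_parity_part (R : realType) (X Y : lmodType R) (e : R) (f : X -> Y)
    (x y : X) :
  D_ (parity_part e f) x y = 2^-1 *: (D_ f x y + e *: D_ f (- x) (- y)).
Proof.
rewrite /D_ /parity_part.
have -> : 2 *: - x + - y = - (2 *: x + y) by lin_comb R.
have -> : 2 *: - x - - y = - (2 *: x - y) by lin_comb R.
have -> : - x + - y = - (x + y) by lin_comb R.
have -> : - x - - y = - (x - y) by lin_comb R.
rewrite !scalerN; lin_comb R.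
Qed.

(** At [x = 0] the first two brackets of [D_] contribute [(7 - 28) * (1 + e)] times [h y], and the
    third adds [-6]. The factor [9 + 7 * e] is 16 for [e = 1] and 2 for [e = -1], so both parities
    are treated at once. *)
Lemma D_parity0 (R : realType) (X Y : lmodType R) (e : R) (h : X -> Y) y :
    (forall x, h (- x) = e *: h x) -> h 0 = 0 ->
  D_ h 0 y = 3 *: (h (2 *: y) - (9 + 7 * e) *: h y).
Proof.
by move=> he h0; rewrite /D_ !scaler0 !add0r he h0; lin_comb R.
Qed.

(** [D_ g x y] is 7 times the difference of the two sides of the mixed equation. *)
Lemma mixed_equation_D (R : realType) (X Y : lmodType R) (g : X -> Y) :
  mixed_equation g <-> forall x y, D_ g x y = 0.
Proof.
split=> gE x y.
  by rewrite /D_ gE; lin_comb R.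
apply: subr0_eq; rewrite -[RHS](scaler0 _ (7^-1)) -(gE x y) /D_.
lin_comb R.
Qed.

(** * Quartic and additive solutions of the mixed equation *)

Lemma quartic0 (R : realType) (X Y : lmodType R) (Q : X -> Y) :
  quartic Q -> Q 0 = 0.
Proof.
move=> /(_ 0 0); rewrite scaler0 subr0 addr0 => E.
by apply: (eq_lin_comb (c := - 24^-1) E); lin_comb R.
Qed.

Lemma quartic_even (R : realType) (X Y : lmodType R) (Q : X -> Y) :
  quartic Q -> forall x, Q (- x) = Q x.
Proof.
move=> Qq x; have := Qq 0 x; rewrite scaler0 !add0r quartic0 // => E.
by apply: (eq_lin_comb (c := - 3^-1) E); lin_comb R.
Qed.

Lemma quartic_double (R : realType) (X Y : lmodType R) (Q : X -> Y) :
  quartic Q -> forall x, Q (2 *: x) = 16 *: Q x.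
Proof.
move=> Qq x; have := Qq x 0; rewrite !subr0 !addr0 quartic0 // => E.
by apply: (eq_lin_comb (c := 2^-1) E); lin_comb R.
Qed.

(** The coefficients match because [3 / 7 * (16 - 2) = 6] and [2 * 16 - 8 = 24]. *)
Lemma even_mixed_quartic (R : realType) (X Y : lmodType R) (Q : X -> Y) :
    (forall x, Q (2 *: x) = 16 *: Q x) -> mixed_equation Q ->
  quartic Q.
Proof. by move=> Q2 QE x y; rewrite QE !Q2; lin_comb R. Qed.

Lemma odd_mixed_additive (R : realType) (X Y : lmodType R) (A : X -> Y) :
    (forall x, A (- x) = - A x) -> (forall x, A (2 *: x) = 2 *: A x) ->
  mixed_equation A -> additive_function A.
Proof.
move=> AN A2 AE.
have E x y : A (2 *: x + y) + A (2 *: x - y)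
    - (4 *: (A (x + y) + A (x - y)) - 4 *: A x) = 0.
  by rewrite AE !A2; lin_comb R.
have jensen x y : A (x + y) + A (x - y) = 2 *: A x.
  have E0 := E x y; have E1 := E x (2 *: y).
  have E2 := E x (x + y); have E3 := E x (x - y).
  have E4 := E (x + y) (x - y); have E5 := E (x - y) (x + y).
  have E6 := E y (x + y); have E7 := E y (x - y).
  have r1 : 2 *: x + 2 *: y = 2 *: (x + y) by lin_comb R.
  have r2 : 2 *: x - 2 *: y = 2 *: (x - y) by lin_comb R.
  have r3 : 2 *: x + (x + y) = 3 *: x + y by lin_comb R.
  have r4 : 2 *: x - (x + y) = x - y by lin_comb R.
  have r5 : x + (x + y) = 2 *: x + y by lin_comb R.
  have r6 : x - (x + y) = - y by lin_comb R.
  have r7 : 2 *: x + (x - y) = 3 *: x - y by lin_comb R.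
  have r8 : 2 *: x - (x - y) = x + y by lin_comb R.
  have r9 : x + (x - y) = 2 *: x - y by lin_comb R.
  have r10 : x - (x - y) = y by lin_comb R.
  have r11 : 2 *: (x + y) + (x - y) = 3 *: x + y by lin_comb R.
  have r12 : 2 *: (x + y) - (x - y) = x + 3 *: y by lin_comb R.
  have r13 : x + y + (x - y) = 2 *: x by lin_comb R.
  have r14 : x + y - (x - y) = 2 *: y by lin_comb R.
  have r15 : 2 *: (x - y) + (x + y) = 3 *: x - y by lin_comb R.
  have r16 : 2 *: (x - y) - (x + y) = x - 3 *: y by lin_comb R.
  have r17 : x - y + (x + y) = 2 *: x by lin_comb R.
  have r18 : x - y - (x + y) = - (2 *: y) by lin_comb R.
  have r19 : 2 *: y + (x + y) = x + 3 *: y by lin_comb R.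
  have r20 : 2 *: y - (x + y) = - (x - y) by lin_comb R.
  have r21 : y + (x + y) = x + 2 *: y by lin_comb R.
  have r22 : y - (x + y) = - x by lin_comb R.
  have r23 : 2 *: y + (x - y) = x + y by lin_comb R.
  have r24 : 2 *: y - (x - y) = - (x - 3 *: y) by lin_comb R.
  have r25 : y + (x - y) = x by lin_comb R.
  have r26 : y - (x - y) = - (x - 2 *: y) by lin_comb R.
  rewrite r1 r2 !A2 in E1; rewrite r3 r4 r5 r6 AN in E2.
  rewrite r7 r8 r9 r10 in E3; rewrite r11 r12 r13 r14 !A2 in E4.
  rewrite r15 r16 r17 r18 AN !A2 in E5.
  rewrite r19 r20 r21 r22 !AN in E6; rewrite r23 r24 r25 r26 !AN in E7.
  (* In [E1 + E4 + E5 - 4 E0 - E2 - E3 - E6 + E7] the values of [A] at [2x ± y], [x ± 2y], [3x ± y],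
     [x ± 3y] and [y] all cancel. What remains is 22 times [A (x + y) + A (x - y) - 2 *: A x]. *)
  have E145 := eq_addZ 1 (eq_addZ 1 E1 E4) E5.
  have E2367 := eq_addZ (-1) (eq_addZ 1 (eq_addZ 1 E2 E3) E6) E7.
  have E' := eq_addZ (-1) (eq_addZ (-4) E145 E0) E2367.
  by apply: (eq_lin_comb (c := 22^-1) E'); lin_comb R.
(* By oddness [A (x - y)] and [A (y - x)] cancel when the two instances are added. *)
move=> x y; have J1 := jensen x y; have J2 := jensen y x.
rewrite -opprB AN (addrC y) in J2.
by apply: (eq_lin_comb (c := 2^-1) (eq_addZ 1 J1 J2)); lin_comb R.
Qed.

(** * The symmetrized control function and the error series *)

Lemma double_half (R : realType) (X : lmodType R) (n : nat) (x : X) :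
  2 *: (2 ^- n.+1 *: x) = 2 ^- n *: x.
Proof. by rewrite scalerA exprS invfM mulrA divff // mul1r. Qed.

Definition psi0_even (R : realType) (X : lmodType R) (psi : X -> X -> R)
    (x : X) : R :=
  (psi 0 x + psi 0 (- x)) / 2.

(** The error bound of the theorem: [16 ^+ i / 3] pays for the even part, and [2 ^+ i] majorizes the
    [2 ^+ i / 3] coming from the odd part. *)
Definition approx_bound (R : realType) (X : lmodType R) (psi : X -> X -> R)
    (x : X) :
    \bar R :=
  (\sum_(0 <= i <oo)
     ((16 ^+ i / 3 + 2 ^+ i) * psi0_even psi (2 ^- i.+1 *: x))%:E)%E.

Lemma psi0_evenN (R : realType) (X : lmodType R) (psi : X -> X -> R) x :
  psi0_even psi (- x) = psi0_even psi x.
Proof. by rewrite /psi0_even opprK addrC. Qed.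

Lemma approx_boundN (R : realType) (X : lmodType R) (psi : X -> X -> R) x :
  approx_bound psi (- x) = approx_bound psi x.
Proof.
by rewrite /approx_bound; apply: eq_eseriesr => i _; rewrite scalerN psi0_evenN.
Qed.

Lemma psi0_even_summable (R : realType) (X : lmodType R) (psi : X -> X -> R)
    (x : X) :
    (forall x y : X, 0 <= psi x y) ->
    (forall x : X,
      (\sum_(0 <= i <oo) (16 ^+ i * psi 0 (2 ^- i.+1 *: x))%:E < +oo)%E) ->
  (\sum_(0 <= i <oo) (16 ^+ i * psi0_even psi (2 ^- i.+1 *: x))%:E < +oo)%E.
Proof.
move=> psi0 psi_sum.
have t0 z i : (0 <= (16 ^+ i * psi 0 (2 ^- i.+1 *: z))%:E)%E.
  by rewrite lee_fin mulr_ge0 ?exprn_ge0.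
(* The average of two nonnegative terms is at most their sum, so the series at [x] and at [- x]
   dominate together. *)
apply: (@le_lt_trans _ _ (\sum_(0 <= i <oo)
    ((16 ^+ i * psi 0 (2 ^- i.+1 *: x))%:E +
     (16 ^+ i * psi 0 (2 ^- i.+1 *: - x))%:E)))%E.
  apply: lee_nneseries => i *.
    by rewrite lee_fin mulr_ge0 ?exprn_ge0 // divr_ge0 ?addr_ge0.
  rewrite -EFinD lee_fin /psi0_even -mulrDr scalerN ler_wpM2l ?exprn_ge0 //.
  have := psi0 0 (2 ^- i.+1 *: x); have := psi0 0 (- (2 ^- i.+1 *: x)); lra.
rewrite nneseriesD; [|by move=> i _ _; exact: t0..].
exact: lte_add_pinfty.
Qed.

(** * Existence: limits of the rescaled even and odd parts *)

Lemma D_cvg (R : realType) (X : lmodType R) (Y : completeNormedModType R)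
    (u : nat -> X -> Y) (g : X -> Y) :
    (forall x, u n x @[n --> \oo] --> g x) ->
  forall x y, D_ (u n) x y @[n --> \oo] --> D_ g x y.
Proof.
move=> ug x y; rewrite /D_.
by apply: cvgB; [apply: cvgD; [apply: cvgB|]|];
  apply: cvgZl_tmp; [apply: cvgD|apply: cvgD|apply: cvgB|apply: cvgB];
  rewrite ?ug //; (try apply: cvgZl_tmp); exact: ug.
Qed.

Lemma norm_parity_part (R : realType) (X : lmodType R)
    (Y : completeNormedModType R) (e : R) (r : X -> Y) (x : X) :
  `|e| = 1 -> `|parity_part e r x| <= (`|r x| + `|r (- x)|) / 2.
Proof.
move=> e1; rewrite /parity_part normrZ ger0_norm ?invr_ge0 // mulrC.
rewrite ler_wpM2r ?invr_ge0 //; apply: le_trans (ler_normD _ _) _.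
by rewrite normrZ e1 mul1r.
Qed.

Lemma parity_partN (R : realType) (X Y : lmodType R) (e : R) (f : X -> Y) x :
  e * e = 1 -> parity_part e f (- x) = e *: parity_part e f x.
Proof.
move=> ee; rewrite /parity_part opprK.
transitivity (2^-1 *: ((e * e) *: f (- x) + e *: f x)); last by lin_comb R.
by rewrite ee scale1r.
Qed.

(** Compares two expressions of [D_ h 0 x] for [h = parity_part e f]: [D_parity0] gives 3 times the
    doubling defect, [D_parity_part] the half sum of [D_ f 0 x] and [e *: D_ f 0 (- x)]. *)
Lemma parity_part_step (R : realType) (X : lmodType R)
    (Y : completeNormedModType R) (psi : X -> X -> R) (f : X -> Y) (e : R) x :
    (forall x y : X, `|D_ f x y| <= psi x y) -> f 0 = 0 ->
    e * e = 1 -> `|e| = 1 ->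
  `|parity_part e f (2 *: x) - (9 + 7 * e) *: parity_part e f x|
    <= psi0_even psi x / 3.
Proof.
move=> Df f0 ee e1; set h := parity_part e f.
have h0 : h 0 = 0 by rewrite /h /parity_part oppr0 f0 scaler0 addr0 scaler0.
have hN z : h (- z) = e *: h z by exact: parity_partN.
rewrite -[X in X <= _](mulfK (_ : 3 != 0)) // ler_wpM2r ?invr_ge0 //.
rewrite mulrC -[X in X * _](ger0_norm (_ : 0 <= 3)) // -normrZ -D_parity0 //.
rewrite D_parity_part oppr0 normrZ ger0_norm ?invr_ge0 // mulrC.
rewrite ler_wpM2r ?invr_ge0 //; apply: le_trans (ler_normD _ _) _.
by rewrite normrZ e1 mul1r lerD.
Qed.

Lemma parity_part_limit (R : realType) (X : lmodType R)
    (Y : completeNormedModType R) (psi : X -> X -> R) (f : X -> Y) (e : R) :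
    (forall x y : X, 0 <= psi x y) ->
    (forall x : X,
      (\sum_(0 <= i <oo) (16 ^+ i * psi 0 (2 ^- i.+1 *: x))%:E < +oo)%E) ->
    (forall x y : X,
      (fun n : nat => 16 ^+ n * psi (2 ^- n *: x) (2 ^- n *: y)) @ \oo
        --> (0 : R)) ->
    (forall x y : X, `|D_ f x y| <= psi x y) -> f 0 = 0 ->
    e * e = 1 -> `|e| = 1 ->
  exists L : X -> Y,
    [/\ forall x, L (- x) = e *: L x,
        forall x, L (2 *: x) = (9 + 7 * e) *: L x,
        mixed_equation L &
        forall x, (`|parity_part e f x - L x|%:E <= \sum_(0 <= i <oo)
          ((9 + 7 * e) ^+ i / 3 * psi0_even psi (2 ^- i.+1 *: x))%:E)%E].
Proof.
move=> psi0 psi_sum psi_lim Df f0 ee e1; set h := parity_part e f.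
set c := 9 + 7 * e.
(* With [c] at most 16, the hypotheses on [psi], stated with powers of 16, control both parities. *)
have /andP[c0 c16] : 0 <= c <= 16.
  have : `|e| <= 1 by rewrite e1.
  by rewrite ler_norml /c => /andP[? ?]; apply/andP; split; lra.
have cn0 n : 0 <= c ^+ n by rewrite exprn_ge0.
have cn n : c ^+ n <= 16 ^+ n by rewrite lerXn2r // nnegrE.
have hN z : h (- z) = e *: h z by exact: parity_partN.
pose u n z := c ^+ n *: h (2 ^- n *: z).
have psi0_even_ge0 z : 0 <= psi0_even psi z by rewrite divr_ge0 ?addr_ge0.
(* This is [parity_part_step] at [2 ^- n.+1 *: x], multiplied by [c ^+ n]; hence the exponent [n.+1]
   in the argument. *)
have ustep x n :
    `|u n.+1 x - u n x| <= c ^+ n / 3 * psi0_even psi (2 ^- n.+1 *: x).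
  have -> : u n.+1 x - u n x = (- c ^+ n) *:
      (h (2 *: (2 ^- n.+1 *: x)) - c *: h (2 ^- n.+1 *: x)).
    by rewrite double_half /u exprS; lin_comb R.
  rewrite normrZ normrN (ger0_norm (cn0 n)) -mulrA ler_wpM2l //.
  by rewrite [_^-1 * _]mulrC; exact: parity_part_step.
have ufin x : (\sum_(0 <= i <oo)
    (c ^+ i / 3 * psi0_even psi (2 ^- i.+1 *: x))%:E < +oo)%E.
  apply: le_lt_trans (psi0_even_summable x psi0 psi_sum).
  apply: lee_nneseries => i *.
    by rewrite lee_fin (mulr_ge0 _ (psi0_even_ge0 _)) // divr_ge0.
  rewrite lee_fin ler_wpM2r // (le_trans _ (cn i)) //.
  by rewrite ler_pdivrMr // ler_peMr // ler1n.
have ucvg x := cvg_summable_steps (ustep x) (ufin x).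
pose L (x : X) : Y := limn (u ^~ x).
have uL x : u n x @[n --> \oo] --> L x by have [] := ucvg x.
have LN x : L (- x) = e *: L x.
  apply: (cvg_unique _ (uL (- x))) => //.
  have -> : u ^~ (- x) = (fun n => e *: u n x).
    by apply/funext => n; rewrite /u scalerN hN; lin_comb R.
  by apply: cvgZl_tmp; exact: uL.
have L0 : L 0 = 0.
  apply: (cvg_unique _ (uL 0)) => //.
  have -> : u ^~ 0 = cst 0; last exact: cvg_cst.
  apply/funext => n; rewrite /u scaler0 /h /parity_part oppr0 f0.
  by rewrite scaler0 addr0 !scaler0.
(* [D_ (u n) x y] is bounded by a sum of two terms, one at [(x, y)] and one at [(- x, - y)], each
   tending to 0 by [psi_lim]. *)
have LD x y : D_ L x y = 0.
  apply/eqP; rewrite -normr_le0.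
  have DL : `|D_ (u n) x y| @[n --> \oo] --> `|D_ L x y|.
    by apply: cvg_norm; exact: D_cvg.
  have psiN : 16 ^+ n * psi (2 ^- n *: x) (2 ^- n *: y) +
    16 ^+ n * psi (2 ^- n *: (- x)) (2 ^- n *: (- y)) @[n --> \oo] --> (0 : R).
    by rewrite -[0]addr0; apply: cvgD; exact: psi_lim.
  apply: (ler_cvg_to DL psiN); apply: nearW => n.
  rewrite D_scale normrZ (ger0_norm (cn0 n)) -mulrDr.
  apply: ler_pM => //; rewrite D_parity_part !scalerN.
  rewrite normrZ ger0_norm ?invr_ge0 //.
  have := ler_normD (D_ f (2 ^- n *: x) (2 ^- n *: y))
    (e *: D_ f (- (2 ^- n *: x)) (- (2 ^- n *: y))).
  rewrite normrZ e1 mul1r.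
  have := Df (2 ^- n *: x) (2 ^- n *: y).
  have := Df (- (2 ^- n *: x)) (- (2 ^- n *: y)).
  have := psi0 (2 ^- n *: x) (2 ^- n *: y).
  have := psi0 (- (2 ^- n *: x)) (- (2 ^- n *: y)).
  lra.
exists L; split=> //.
(* The doubling law is read off from [D_ L 0 x = 0]. *)
- move=> x; have := LD 0 x; rewrite (D_parity0 _ LN L0) -/c => E.
  by apply: (eq_lin_comb (c := 3^-1) E); lin_comb R.
- exact/mixed_equation_D.
- move=> x; have [_] := ucvg x; by rewrite {1}/u expr0 scale1r invr1 scale1r.
Qed.

(** * Uniqueness by rescaling *)

Lemma scaled_approx_bound_cvg0 (R : realType) (X : lmodType R)
    (psi : X -> X -> R) (c : R) (x : X) :
    (forall x y : X, 0 <= psi x y) ->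
    (forall x : X,
      (\sum_(0 <= i <oo) (16 ^+ i * psi 0 (2 ^- i.+1 *: x))%:E < +oo)%E) ->
    0 <= c <= 16 ->
  ((c ^+ n)%:E * approx_bound psi (2 ^- n *: x))%E @[n --> \oo] --> 0%E.
Proof.
move=> psi0 psi_sum /andP[c0 c16].
have psi0_even_ge0 z : 0 <= psi0_even psi z by rewrite divr_ge0 ?addr_ge0.
pose w i := ((16 ^+ i * psi0_even psi (2 ^- i.+1 *: x))%:E)%E.
have w0 i : (0 <= w i)%E by rewrite lee_fin mulr_ge0 ?exprn_ge0.
(* The [i]-th term of the rescaled bound is at most [2 * w (n + i)], since [16 ^+ i / 3 + 2 ^+ i] is
   at most [2 * 16 ^+ i]. The whole is thus squeezed under twice a tail of a convergent series. *)
have := nneseries_tail_cvg (P := xpredT) (psi0_even_summable x psi0 psi_sum)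
  (fun i _ => w0 i).
move=> /(cvgeZl (_ : 2%:E \is a fin_num)) => /(_ isT).
rewrite mule0 => tail.
apply: (squeeze_cvge _ (cvg_cst 0%E) tail); apply: nearW => n.
have b0 i z : (0 <= ((16 ^+ i / 3 + 2 ^+ i) * psi0_even psi z)%:E :> \bar R)%E.
  by rewrite lee_fin (mulr_ge0 _ (psi0_even_ge0 _)) //
    addr_ge0 ?divr_ge0 ?exprn_ge0.
rewrite /approx_bound -nneseriesZl //; apply/andP; split.
  apply: nneseries_ge0 => i _ _; rewrite -EFinM lee_fin mulr_ge0 ?exprn_ge0 //.
  by rewrite -lee_fin.
rewrite -(nneseries_addn n w0) -nneseriesZl //.
apply: lee_nneseries => i *.
  by rewrite -EFinM lee_fin mulr_ge0 ?exprn_ge0 // -lee_fin.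
rewrite -!EFinM lee_fin scalerA -invfM -exprD addSn.
rewrite [X in _ <= X]mulrA mulrA ler_wpM2r //.
have ci : c ^+ n <= 16 ^+ n by rewrite lerXn2r // nnegrE.
have i16 : 2 ^+ i <= 16 ^+ i :> R by rewrite lerXn2r // ?nnegrE // ler_nat.
have p16 : 0 <= 16 ^+ i :> R by rewrite exprn_ge0.
rewrite addnC exprD mulrCA; apply: ler_pM; rewrite ?exprn_ge0 //; lra.
Qed.

(** [G x - H x] equals [c ^+ n] times the difference at [2 ^- n *: x], which the rescaled bound
    sends to 0. *)
Lemma scaled_limit_unique (R : realType) (X : lmodType R)
    (Y : completeNormedModType R) (psi : X -> X -> R) (c : R) (G H : X -> Y) :
    (forall x y : X, 0 <= psi x y) ->
    (forall x : X,
      (\sum_(0 <= i <oo) (16 ^+ i * psi 0 (2 ^- i.+1 *: x))%:E < +oo)%E) ->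
    0 <= c <= 16 ->
    (forall x, G (2 *: x) = c *: G x) -> (forall x, H (2 *: x) = c *: H x) ->
    (forall x, (`|G x - H x|%:E <= 2%:E * approx_bound psi x)%E) ->
  G = H.
Proof.
move=> psi0 psi_sum /andP[c0 c16] G2 H2 GH; apply/funext => x.
have iter (K : X -> Y) n : (forall x, K (2 *: x) = c *: K x) ->
    K x = c ^+ n *: K (2 ^- n *: x).
  move=> K2; elim: n => [|n ->]; first by rewrite expr0 invr1 !scale1r.
  by rewrite exprSr -scalerA -K2 double_half.
have lim0 := scaled_approx_bound_cvg0 x psi0 psi_sum (_ : 0 <= c <= 16).
have := lim0; rewrite c0 c16 => /(_ isT) /(cvgeZl (_ : 2%:E \is a fin_num)).
move=> /(_ isT); rewrite mule0 => {}lim0.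
apply: subr0_eq; apply/eqP; rewrite -normr_le0 -lee_fin.
apply: (cvge_to_ge lim0); apply: nearW => n.
rewrite (iter G n G2) (iter H n H2) -scalerBr normrZ ger0_norm ?exprn_ge0 //.
by rewrite EFinM muleCA; apply: lee_wpmul2l; rewrite ?lee_fin ?exprn_ge0.
Qed.

(** The parity part is at most the average of [|r x|] and [|r (- x)|], hence at most the larger of
    them, and the bound is even in [x]. *)
Lemma parity_part_le_approx_bound (R : realType) (X : lmodType R)
    (Y : completeNormedModType R) (psi : X -> X -> R) (e : R) (r : X -> Y) x :
    `|e| = 1 -> (forall x, (`|r x|%:E <= 2%:E * approx_bound psi x)%E) ->
  (`|parity_part e r x|%:E <= 2%:E * approx_bound psi x)%E.
Proof.
move=> e1 rb; have := norm_parity_part r x e1 => pr.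
have [rx|rx] := leP `|r (- x)| `|r x|.
  by apply: le_trans (rb x); rewrite lee_fin; lra.
by rewrite -approx_boundN; apply: le_trans (rb (- x)); rewrite lee_fin; lra.
Qed.

Lemma additiveN (R : realType) (X Y : lmodType R) (A : X -> Y) :
  additive_function A -> forall x, A (- x) = - A x.
Proof.
move=> AD x; have A0 : A 0 = 0.
  have := AD 0 0; rewrite addr0 => E.
  by apply: (eq_lin_comb (c := -1) E); lin_comb R.
by apply/eqP; rewrite -addr_eq0 -AD addNr A0.
Qed.

Lemma additive_double (R : realType) (X Y : lmodType R) (A : X -> Y) :
  additive_function A -> forall x, A (2 *: x) = 2 *: A x.
Proof. by move=> AD x; rewrite !scaler_nat !mulr2n AD. Qed.

Lemma quartic_additive_approx_unique (R : realType) (X : lmodType R)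
    (Y : completeNormedModType R) (psi : X -> X -> R) (f Q1 Q2 A1 A2 : X -> Y) :
    (forall x y : X, 0 <= psi x y) ->
    (forall x : X,
      (\sum_(0 <= i <oo) (16 ^+ i * psi 0 (2 ^- i.+1 *: x))%:E < +oo)%E) ->
    quartic Q1 -> quartic Q2 -> additive_function A1 -> additive_function A2 ->
    (forall x, (`|f x - Q1 x - A1 x|%:E <= approx_bound psi x)%E) ->
    (forall x, (`|f x - Q2 x - A2 x|%:E <= approx_bound psi x)%E) ->
  Q1 = Q2 /\ A1 = A2.
Proof.
move=> psi0 psi_sum Q1q Q2q A1D A2D f1 f2.
have Q1N := quartic_even Q1q; have Q2N := quartic_even Q2q.
have A1N := additiveN A1D; have A2N := additiveN A2D.
(* Here [f] cancels: [r] is [Q1 - Q2] plus [A1 - A2], and these are its even and odd parts, so each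
   inherits the bound on [r]. *)
pose r x := (f x - Q2 x - A2 x) - (f x - Q1 x - A1 x).
have rb x : (`|r x|%:E <= 2%:E * approx_bound psi x)%E.
  apply: (@le_trans _ _ (`|f x - Q2 x - A2 x|%:E + `|f x - Q1 x - A1 x|%:E)%E).
    by rewrite -EFinD lee_fin ler_normB.
  by apply: le_trans (leeD (f2 x) (f1 x)) _; rewrite -mule2n mule_natl.
have rQ x : Q1 x - Q2 x = parity_part 1 r x.
  by rewrite /parity_part /r Q1N Q2N A1N A2N; lin_comb R.
have rA x : A1 x - A2 x = parity_part (-1) r x.
  by rewrite /parity_part /r Q1N Q2N A1N A2N; lin_comb R.
split.
  apply: (scaled_limit_unique (c := 16) psi0 psi_sum).
  - by rewrite ler0n lexx.
  - exact: quartic_double.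
  - exact: quartic_double.
  - by move=> x; rewrite rQ parity_part_le_approx_bound ?normr1.
apply: (scaled_limit_unique (c := 2) psi0 psi_sum).
- by rewrite ler0n ler_nat.
- exact: additive_double.
- exact: additive_double.
- by move=> x; rewrite rA parity_part_le_approx_bound ?normrN1.
Qed.

(** * Assembly of the even and odd approximations *)

Theorem theorem3p8 (R : realType) (X : normedModType R)
    (Y : completeNormedModType R) (psi : X -> X -> R) (f : X -> Y)
    (psi_ge0 : forall x y : X, 0 <= psi x y)
    (psi_sum : forall x : X,
      (\sum_(0 <= i <oo) (16 ^+ i * psi 0 (2 ^- i.+1 *: x))%:E < +oo)%E)
    (psi_lim : forall x y : X,
      (fun n : nat => 16 ^+ n * psi (2 ^- n *: x) (2 ^- n *: y)) @ \oo
        --> (0 : R))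
    (Df_le : forall x y : X, `|D_ f x y| <= psi x y)
    (f0 : f 0 = 0) :
  exists! QA : (X -> Y) * (X -> Y),
    [/\ quartic QA.1, additive_function QA.2,
        mixed_equation QA.1, mixed_equation QA.2 &
        forall x : X,
          (`|f x - QA.1 x - QA.2 x|%:E <=
           \sum_(0 <= i <oo)
             ((16 ^+ i / 3 + 2 ^+ i) *
              ((psi 0 (2 ^- i.+1 *: x) + psi 0 (- (2 ^- i.+1 *: x))) / 2))%:E)%E].
Proof.
have n1 : `|1 : R| = 1 := normr1 R.
have nN1 : `|-1 : R| = 1 := normrN1 R.
have NN1 : -1 * -1 = 1 :> R by rewrite mulrNN mulr1.
have [Q [_ Q2 Qmix Qf]] := parity_part_limit psi_ge0 psi_sum psi_lim Df_le f0
  (mulr1 1) n1.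
have [A [AN A2 Amix Af]] := parity_part_limit psi_ge0 psi_sum psi_lim Df_le f0
  NN1 nN1.
have e16 : 9 + 7 * 1 = 16 :> R by lra.
have e2 : 9 + 7 * -1 = 2 :> R by lra.
rewrite e16 in Q2 Qf; rewrite e2 in A2 Af.
have Qq : quartic Q by exact: even_mixed_quartic.
have AD : additive_function A.
  by apply: odd_mixed_additive => // x; rewrite AN scaleN1r.
have QAf x : (`|f x - Q x - A x|%:E <= approx_bound psi x)%E.
  have psi0_even_ge0 z : 0 <= psi0_even psi z by rewrite divr_ge0 ?addr_ge0.
  have t0 (c : R) i : 0 <= c ->
      (0 <= (c ^+ i / 3 * psi0_even psi (2 ^- i.+1 *: x))%:E)%E.
    by move=> c0; rewrite lee_fin (mulr_ge0 _ (psi0_even_ge0 _))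
      ?divr_ge0 ?exprn_ge0.
  (* [f] is the sum of its even and odd parts, so the two error series add up. *)
  have -> : f x - Q x - A x =
      (parity_part 1 f x - Q x) + (parity_part (-1) f x - A x).
    by rewrite /parity_part; lin_comb R.
  apply: (@le_trans _ _ (`|parity_part 1 f x - Q x|%:E +
                         `|parity_part (-1) f x - A x|%:E)%E).
    by rewrite -EFinD lee_fin ler_normD.
  apply: le_trans (leeD (Qf x) (Af x)) _.
  rewrite -nneseriesD; [|by move=> i _ _; exact: t0..].
  apply: lee_nneseries => i *; first by rewrite adde_ge0 // t0.
  rewrite -EFinD lee_fin -mulrDl ler_wpM2r //.
  (* The sum has coefficient [16 ^+ i / 3 + 2 ^+ i / 3]; nonnegativity allows the last third to be
     dropped. *)
  have : 0 <= 2 ^+ i :> R by rewrite exprn_ge0.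
  lra.
exists (Q, A); split=> [//|[Q' A'] /= [Q'q A'D _ _ Q'A'f]].
by have [-> ->] :=
  quartic_additive_approx_unique psi_ge0 psi_sum Qq Q'q AD A'D QAf Q'A'f.
Qed.
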